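(* Let $K$ and $L$ be locally compact Hausdorff spaces and let $X$ be a real Banach space containing no isomorphic copy of $c_0$. Assume that either $X$ is separable or $X^*$ has the Radon–Nikodým property. If there exists an isomorphic embedding of $C_0(K)$ into $C_0(L,X)$, then either $K$ is finite or $|K|\leq |L|$.
   Context: For a locally compact Hausdorff space $K$ and a real Banach space $X$, $C_0(K,X)$ denotes the Banach space of all continuous functions $f:K\to X$ vanishing at infinity, with the norm $\|f\|=\sup_{x\in K}\|f(x)\|$; $C_0(K)=C_0(K,\mathbb{R})$, and $c_0=C_0(\mathbb{N})$. A linear operator $T:X\to Y$ between Banach spaces is an isomorphic embedding if there are $A,B>0$ with $A\|u\|\le\|Tu\|\le B\|u\|$ for all $u\in X$; ''$Y$ contains a copy of $X$'' means such an embedding exists. $|\Gamma|$ denotes the cardinality of a set $\Gamma$. *)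

(* Defs.v *)
From HB Require Import structures.
From mathcomp Require Import all_boot all_order all_algebra.
From mathcomp Require Import all_classical all_reals all_analysis.
Set Implicit Arguments. Unset Strict Implicit. Unset Printing Implicit Defensive.
Import Order.TTheory GRing.Theory Num.Theory.
Import numFieldNormedType.Exports.
Local Open Scope classical_set_scope.
Local Open Scope ring_scope.

Section Defs.
Variable R : realType.

(* sup norm ||f||_oo = sup_x ||f x|| (sup of the empty set is 0) *)
Definition supn {T : Type} {V : normedZmodType R} (f : T -> V) : R :=
  sup [set `|f x| | x in [set: T]].

Definition C0 {K : topologicalType} {V : normedModType R} (f : K -> V) : Prop :=
  continuous f /\ forall e : R, 0 < e -> compact [set x | e <= `|f x|].

Definition iso_embedding_C0 {K L : topologicalType} {X : normedModType R}
  (T : (K -> R) -> (L -> X)) : Prop :=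
  (forall f, C0 f -> C0 (T f)) /\
  (forall (a : R) (f g : K -> R), C0 f -> C0 g ->
     T (fun x => a * f x + g x) = (fun y => a *: T f y + T g y)) /\
  exists A B : R, 0 < A /\ 0 < B /\
     forall f, C0 f -> A * supn f <= supn (T f) /\ supn (T f) <= B * supn f.

Definition c0seq (u : nat -> R) : Prop := u @ \oo --> (0 : R).

Definition iso_embedding_c0 {X : normedModType R} (T : (nat -> R) -> X) : Prop :=
  (forall (a : R) (u v : nat -> R), c0seq u -> c0seq v ->
     T (fun n => a * u n + v n) = a *: T u + T v) /\
  exists A B : R, 0 < A /\ 0 < B /\
     forall u, c0seq u -> A * supn u <= `|T u| /\ `|T u| <= B * supn u.

Definition contains_c0 (X : normedModType R) : Prop :=
  exists T : (nat -> R) -> X, iso_embedding_c0 T.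

Definition separable_space (X : normedModType R) : Prop :=
  exists D : set X, countable D /\ dense D.

Definition is_dual {X : normedModType R} (phi : X -> R) : Prop :=
  (forall (a : R) (x y : X), phi (a *: x + y) = a * phi x + phi y) /\
  continuous phi.

Definition dnorm {X : normedModType R} (phi : X -> R) : R :=
  sup [set `|phi x| | x in [set x : X | `|x| <= 1]].

Section RNP.
Variable X : normedModType R.
Variables (d : measure_display) (O : measurableType d).
Variable mu : {finite_measure set O -> \bar R}.

Definition dual_simple (g : O -> (X -> R)) : Prop :=
  exists s : seq (set O * (X -> R)),
    (forall p, p \in s -> measurable p.1 /\ is_dual p.2) /\
    forall w x, g w x = \sum_(p <- s) (indic p.1 w : R) * p.2 x.

Definition dual_vector_measure (F : set O -> (X -> R)) : Prop :=
  (forall A, measurable A -> is_dual (F A)) /\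
  (forall A : nat -> set O, (forall n, measurable (A n)) ->
     trivIset [set: nat] A ->
     (fun n => dnorm (fun x => F (\bigcup_k A k) x - \sum_(k < n) F (A k) x))
       @ \oo --> (0 : R)).

Definition bounded_variation (F : set O -> (X -> R)) : Prop :=
  exists M : R, forall (n : nat) (A : nat -> set O),
    (forall i, measurable (A i)) -> trivIset `I_n A ->
    \big[setU/set0]_(i < n) A i = [set: O] ->
    \sum_(i < n) dnorm (F (A i)) <= M.

Definition mu_continuous (F : set O -> (X -> R)) : Prop :=
  forall A, measurable A -> mu A = 0%E -> F A = (fun _ => 0).

(* f is a Bochner integrable density of F:  f is a pointwise limit (in the
   dual norm) of simple functions, int ||f|| dmu < oo, and
   F(A) = (Bochner) int_A f dmu, tested against the points of X *)
Definition bochner_density (F : set O -> (X -> R)) (f : O -> (X -> R)) : Prop :=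
  (forall w, is_dual (f w)) /\
  (exists g : nat -> O -> (X -> R), (forall n, dual_simple (g n)) /\
     forall w, (fun n => dnorm (fun x => f w x - g n w x)) @ \oo --> (0 : R)) /\
  (\int[mu]_w (dnorm (f w))%:E < +oo)%E /\
  forall A, measurable A -> forall x : X,
    ((F A x)%:E = \int[mu]_(w in A) (f w x)%:E)%E.
End RNP.

Definition dual_has_RNP (X : normedModType R) : Prop :=
  forall (d : measure_display) (O : measurableType d)
         (mu : {finite_measure set O -> \bar R}) (F : set O -> (X -> R)),
    dual_vector_measure F -> bounded_variation F -> mu_continuous mu F ->
    exists f : O -> (X -> R), bochner_density mu F f.

End Defs.

(* Main.v *)
Require Import Defs.
From HB Require Import structures.
From mathcomp Require Import all_boot all_order all_algebra.
From mathcomp Require Import all_classical all_reals all_analysis.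
From mathcomp Require Import ring lra.
Set Implicit Arguments. Unset Strict Implicit. Unset Printing Implicit Defensive.
Import Order.TTheory GRing.Theory Num.Theory.
Import numFieldNormedType.Exports.
Local Open Scope classical_set_scope.
Local Open Scope ring_scope.

(** Let [T] embed [C0 K] into [C0 (L, X)] with lower constant [A], and say that
    [T] [d]-concentrates at [x] over [y] if functions of norm at most 1 supported
    in arbitrarily small neighbourhoods of [x] can have [`|T g y| >= d].

    For fixed [y] only finitely many [x] qualify: otherwise there are disjointly
    supported [g n] of norm at most 1 with [`|T (g n) y| >= d]; the series of the
    [T (g n) y] is weakly unconditionally Cauchy with terms bounded away from 0,
    and by Bessaga-Pelczynski (via Rosenthal's disjointification) [X] contains
    [c0].

    Every [x] qualifies for some [y], with [d = A / 4]. Otherwise choose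
    neighbourhoods [U n] of [x] and functions [f n] supported in [U n] with
    [0 <= f n <= 1 = f n x]; by compactness [U n.+1] can be so small that, for
    every [y], [`|T (f n) y| <= d + `|T g y|] for some [g] supported in
    [U n `\` U n.+1]. These [g] being disjoint as [n] varies, [`|T (f n) y|] is
    eventually at most [2 * d], pointwise in [y]. If the [f n] nearly minimize
    suitable norms, the argument of Simons' inequality, applied at a point where
    the norm of [T (\sum_n f n / 2 ^ n.+1)] is attained, contradicts the lower
    bound [A].

    Hence [K] is a union of finite sets indexed by [L]. *)

(** * Norming functionals *)

Section HahnBanach.
Variables (R : realType) (V : lmodType R).
Implicit Types (p q : V -> R).

Definition sublinear p : Prop :=
  (forall x y, p (x + y) <= p x + p y) /\
  (forall (a : R) x, 0 <= a -> p (a *: x) = a * p x).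

Lemma sublinear_opp p x : sublinear p -> - p (- x) <= p x.
Proof.
move=> [pD pZ]; have := pD x (- x); rewrite subrr.
have := pZ 0 0 (lexx _); rewrite scale0r mul0r => -> ; lra.
Qed.

Definition slide p (y x : V) : R :=
  inf [set p (x + t *: y) - t * p y | t in [set t : R | 0 <= t]].

Lemma slide_has_inf p y x : sublinear p ->
  has_inf [set p (x + t *: y) - t * p y | t in [set t : R | 0 <= t]].
Proof.
move=> sp; split; first by exists (p (x + 0 *: y) - 0 * p y), 0 => /=.
exists (- p (- x)) => _ [t /= t0 <-].
have [pD pZ] := sp.
have := pD (x + t *: y) (- x); rewrite addrAC subrr add0r pZ//; lra.
Qed.

Lemma slide_le p y x t : sublinear p -> 0 <= t ->
  slide p y x <= p (x + t *: y) - t * p y.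
Proof.
move=> sp t0; apply: ge_inf; first by case: (slide_has_inf y x sp).
by exists t.
Qed.

Lemma slide_sublinear p y : sublinear p -> sublinear (slide p y).
Proof.
move=> sp; have [pD pZ] := sp; split=> [x z|a x a0].
  apply/ler_addgt0Pr => e e0.
  have e20 : 0 < e / 2 by lra.
  have [_ [s /= s0 <-] hs] := inf_adherent e20 (slide_has_inf y x sp).
  have [_ [t /= t0 <-] ht] := inf_adherent e20 (slide_has_inf y z sp).
  have := slide_le y (x + z) sp (addr_ge0 s0 t0).
  have := pD (x + s *: y) (z + t *: y).
  rewrite addrACA -scalerDl -/(slide p y x) -/(slide p y z) in hs ht *.
  lra.
have [->|aN0] := eqVneq a 0.
  rewrite scale0r mul0r; apply/eqP; rewrite eq_le; apply/andP; split.
    by have := slide_le y 0 sp (lexx 0); rewrite scale0r addr0 mul0r subr0 -[X in p X](scale0r 0) pZ// mul0r.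
  apply: lb_le_inf; first by case: (slide_has_inf y 0 sp).
  by move=> _ [t /= t0 <-]; rewrite add0r pZ// subrr.
have {}a0 : 0 < a by rewrite lt_neqAle eq_sym aN0.
(* One inequality for all positive factors suffices: the converse is the case of the factor [a^-1]
   at [a *: x]. *)
have le1 (b : R) z : 0 < b -> slide p y (b *: z) <= b * slide p y z.
  move=> b0; rewrite -ler_pdivrMl//; apply: lb_le_inf; first by case: (slide_has_inf y z sp).
  move=> _ [t /= t0 <-]; rewrite ler_pdivrMl//.
  have := slide_le y (b *: z) sp (mulr_ge0 (ltW b0) t0).
  by rewrite -scalerA -scalerDr pZ; [rewrite mulrBr mulrA|exact: ltW].
apply/eqP; rewrite eq_le le1//=.
have := le1 a^-1 (a *: x); rewrite invr_gt0 => /(_ a0).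
by rewrite scalerA mulVf// scale1r ler_pdivlMl.
Qed.

(** Zorn's lemma for the reversed pointwise order. The infimum of a nonempty chain is finite because
    [- p (- x)] bounds it below, and subadditive because two near-minimizing members of the chain
    are comparable. *)
Lemma sublinear_minimal p : sublinear p ->
  exists q, [/\ sublinear q, (forall x, q x <= p x) &
    forall r, sublinear r -> (forall x, r x <= q x) -> r = q].
Proof.
move=> sp; pose Q := {q | sublinear q /\ forall x, q x <= p x}.
pose r (f g : Q) := `[< forall x, sval g x <= sval f x >].
have [| | | |[q [sq qp]] qmin] := @Zorn Q r.
- by move=> f; apply/asboolP => x.
- by move=> f g h /asboolP fg /asboolP gh; apply/asboolP => x; exact: le_trans (fg x).
- move=> [f ?] [g ?] /asboolP fg /asboolP gf; apply/eq_exist/funext => x.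
  by apply/eqP; rewrite eq_le fg gf.
- move=> A Atot; have [[f0 Af0]|A0] := pselect (exists f, A f); last first.
    by exists (exist _ p (conj sp (fun x => lexx _))) => f Af; case: A0; exists f.
  pose m x := inf [set sval f x | f in A].
  have hm x : has_inf [set sval f x | f in A].
    split; first by exists (sval f0 x), f0.
    exists (- p (- x)) => _ [[f [sf fp]] _ <-] /=.
    by rewrite (le_trans _ (sublinear_opp _ sf))// lerN2.
  have mle f x : A f -> m x <= sval f x.
    by move=> Af; apply: ge_inf; [case: (hm x)|exists f].
  have sm : sublinear m.
    split=> [x y|a x a0].
      apply/ler_addgt0Pr => e e0; have e20 : 0 < e / 2 by lra.
      have [_ [f Af <-] hf] := inf_adherent e20 (hm x).
      have [_ [g Ag <-] hg] := inf_adherent e20 (hm y).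
      rewrite -/(m x) -/(m y) in hf hg.
      have [/asboolP fg|/asboolP gf] := Atot _ _ Af Ag.
        have := fg x; have := fg y; have := mle _ (x + y) Ag.
        have [[gD _] _] := svalP g; have := gD x y; lra.
      have := gf x; have := gf y; have := mle _ (x + y) Af.
      have [[fD _] _] := svalP f; have := fD x y; lra.
    have [->|aN0] := eqVneq a 0.
      rewrite scale0r mul0r /m (_ : [set _ | _ in _] = [set 0]) ?inf1//.
      apply/seteqP; split=> [_ [f Af <-]|_ ->] /=.
        by have [[_ fZ] _] := svalP f; rewrite -(scale0r (0 : V)) fZ// mul0r.
      by exists f0 => //; have [[_ fZ] _] := svalP f0; rewrite -(scale0r (0 : V)) fZ// mul0r.
    have {}a0 : 0 < a by rewrite lt_neqAle eq_sym aN0.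
    have le1 (b : R) z : 0 < b -> m (b *: z) <= b * m z.
      move=> b0; rewrite -ler_pdivrMl//; apply: lb_le_inf; first by case: (hm z).
      move=> _ [f Af <-]; rewrite ler_pdivrMl//.
      have [[_ fZ] _] := svalP f; rewrite -fZ; [exact: mle|exact: ltW].
    apply/eqP; rewrite eq_le le1//=.
    have := le1 a^-1 (a *: x); rewrite invr_gt0 => /(_ a0).
    by rewrite scalerA mulVf// scale1r ler_pdivlMl.
  have mp x : m x <= p x.
    by apply: (le_trans (mle _ x Af0)); case: (svalP f0).
  by exists (exist _ m (conj sm mp)) => f Af; apply/asboolP => x; exact: mle.
exists q; split => // s ss sq'.
have sp' x : s x <= p x by exact: le_trans (qp x).
have : r (exist _ q (conj sq qp)) (exist _ s (conj ss sp')) by apply/asboolP.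
by move=> /qmin /(congr1 sval).
Qed.

(* A minimal sublinear functional [q] equals [slide q y] for every [y], and
   [slide q y (- y) <= - q y]; hence [q (- y) = - q y] and [q] is linear. *)
Lemma sublinear_dominates p : sublinear p ->
  exists q : V -> R, [/\ forall (a : R) x y, q (a *: x + y) = a * q x + q y,
    forall x, q x <= p x & forall x, q (- x) = - q x].
Proof.
move=> /sublinear_minimal[q [sq qp qmin]]; have [qD qZ] := sq.
have qN x : q (- x) = - q x.
  have sl : slide q x = q.
    apply: qmin; first exact: slide_sublinear.
    by move=> z; have := slide_le x z sq (lexx 0); rewrite scale0r addr0 mul0r subr0.
  have := slide_le x (- x) sq ler01.
  rewrite sl scale1r mul1r addNr -(scale0r (0 : V)) qZ// mul0r.
  by have := sublinear_opp x sq; lra.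
have qD' x y : q (x + y) = q x + q y.
  have h1 := qD x y; have := qD (x + y) (- y); rewrite addrK qN; lra.
exists q; split => // a x y; rewrite qD'; congr (_ + _).
have [a0|a0] := leP 0 a; first exact: qZ.
rewrite -(opprK (a *: x)) qN -scaleNr qZ; first by rewrite mulNr opprK.
by rewrite oppr_ge0 ltW.
Qed.

End HahnBanach.

(** Domination is applied to [slide u] of the norm, not to the norm itself, which forces the value
    at [u]. *)
Lemma norming_functional (R : realType) (V : normedModType R) (u : V) :
  exists phi : V -> R, [/\ forall (a : R) x y, phi (a *: x + y) = a * phi x + phi y,
    forall x, `|phi x| <= `|x| & phi u = `|u|].
Proof.
have sn : sublinear (fun x : V => `|x|).
  by split=> [x y|a x a0]; [exact: ler_normD|rewrite normrZ ger0_norm].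
have [q [ql qle qN]] := sublinear_dominates (slide_sublinear u sn).
have qn x : q x <= `|x|.
  apply: (le_trans (qle x)); have := slide_le u x sn (lexx 0).
  by rewrite scale0r addr0 mul0r subr0.
exists q; split=> //.
  move=> x; rewrite ler_norml qn andbT lerNl -qN -[leRHS]normrN; exact: qn.
apply/eqP; rewrite eq_le qn /=.
have := qle (- u); have := slide_le u (- u) sn ler01.
by rewrite scale1r mul1r addNr normr0 qN; lra.
Qed.

(** * Unconditional series and copies of c0 *)

Section Supn.
Variables (R : realType) (T : Type) (V : normedZmodType R).
Implicit Type f : T -> V.

Lemma supn_ub f (M : R) x : (forall z, `|f z| <= M) -> `|f x| <= supn f.
Proof. by move=> fM; apply: ub_le_sup; [exists M => y [z _ <-]|exists x]. Qed.

Lemma supn_le f (c : R) : 0 <= c -> (forall x, `|f x| <= c) -> supn f <= c.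
Proof.
move=> c0 fc; have [[x _]|T0] := pselect ([set: T] !=set0).
  by apply: ge_sup; [exists `|f x|; exists x|move=> y [z _ <-]].
rewrite /supn (_ : [set _ | _ in _] = set0) ?sup0//.
by apply/seteqP; split=> // r [x _ _]; case: T0; exists x.
Qed.

(** For unbounded [f] or empty [T], [sup] takes its default value 0. *)
Lemma supn_ge0 f : 0 <= supn f.
Proof.
have [ub|nub] := pselect (has_ubound [set `|f x| | x in [set: T]]); last first.
  by rewrite /supn sup_out// => -[].
have [[x _]|T0] := pselect ([set: T] !=set0).
  by apply: (le_trans (normr_ge0 (f x))); apply: ub_le_sup => //; exists x.
by rewrite /supn sup_out// => -[[r [x _ _]] _]; case: T0; exists x.
Qed.

End Supn.

(* Split the index set into infinitely many infinite blocks. If the claim fails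
   on each block, picking one bad row per block gives a subsequence whose
   off-diagonal row sums have dropped by [d]. *)
Lemma rosenthal_disjointification (R : realType) (a : nat -> nat -> R) (M d : R) :
  0 < d -> (forall n k, 0 <= a n k) ->
  (forall n s, uniq s -> \sum_(k <- s) a n k <= M) ->
  exists2 sigma : nat -> nat, injective sigma &
    forall n s, uniq s -> n \notin s -> \sum_(k <- s) a (sigma n) (sigma k) <= d.
Proof.
move=> d0 a0 aM.
pose offdiag (sigma : nat -> nat) c :=
  forall n s, uniq s -> n \notin s -> \sum_(k <- s) a (sigma n) (sigma k) <= c.
suff: forall m sigma, injective sigma -> offdiag sigma (m%:R * d) ->
    exists2 tau, injective tau & offdiag tau d.
  (* All row sums are at most [M], hence at most [m%:R * d] for an integer [m] above [M / d]; the
     induction on [m] starts from there. *)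
  move=> /(_ (Num.bound (M / d)) id); apply => // n s us _.
  apply: le_trans (aM n s us) _; rewrite -ler_pdivrMr// ltW// archi_boundP//.
  by apply: divr_ge0; [have := aM 0 [::] isT; rewrite big_nil|exact: ltW].
elim=> [|m IH] sigma sI sb.
  exists sigma => // n s us ns; apply: le_trans (sb n s us ns) _.
  by rewrite mul0r ltW.
pose pr (p k : nat) := pickle (p, k).
have prI p k q l : pr p k = pr q l -> p = q /\ k = l.
  by move=> /(pcan_inj pickleK)[].
have [[p hp]|/forallNP H] := pselect (exists p, offdiag (sigma \o pr p) d).
  by exists (sigma \o pr p) => // k l /sI /prI[].
have {}H p : exists n, exists s, [/\ uniq s, n \notin s &
    d < \sum_(k <- s) a (sigma (pr p n)) (sigma (pr p k))].
  apply/not_existsP => Hp; apply: (H p) => n s us ns.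
  by rewrite leNgt; apply/negP => h; apply: (Hp n); exists s.
have [n Hn] := choice H; have [s Hs] := choice Hn.
apply: (IH (fun p => sigma (pr p (n p)))); first by move=> p q /sI /prI[].
move=> p t ut pt.
have [us ns ds] := Hs p.
(* The bad row is summed over the new indices and its own witness [s p] together. The total is at
   most [m.+1%:R * d] and the witness takes more than [d], leaving [m%:R * d]. *)
have := sb (pr p (n p)) ([seq pr q (n q) | q <- t] ++ [seq pr p k | k <- s p]).
rewrite big_cat !big_map -natr1 mulrDl mul1r => h.
suff : \sum_(j <- t) a (sigma (pr p (n p))) (sigma (pr j (n j))) +
   \sum_(j <- s p) a (sigma (pr p (n p))) (sigma (pr p j)) <= m%:R * d + d by lra.
apply: h.
  rewrite cat_uniq !map_inj_uniq ?ut ?us ?andbT; last 2 first.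
  - by move=> k l /prI[].
  - by move=> k l /prI[].
  by apply/hasPn => _ /mapP[k ks ->]; apply/negP => /mapP[q qt /prI[pq _]]; rewrite pq qt in pt.
rewrite mem_cat negb_or; apply/andP; split; apply/negP => /mapP[q qt /prI[pq nk]].
  by rewrite pq qt in pt.
by rewrite nk qt in ns.
Qed.

(* Quantifying over duplicate-free lists instead of initial segments makes this
   stable under injective reindexing. *)
Definition unconditional {R : realType} {X : normedModType R} (u : nat -> X) (M : R) :=
  forall (s : seq nat) (a : nat -> R), uniq s -> (forall i, `|a i| <= 1) ->
    `|\sum_(i <- s) a i *: u i| <= M.

Section UnconditionalC0.
Variables (R : realType) (X : completeNormedModType R) (u : nat -> X) (M : R).
Hypothesis uM : unconditional u M.

Lemma unconditional_ge0 : 0 <= M.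
Proof.
have z1 (i : nat) : `|0 : R| <= 1 by rewrite normr0.
by have := uM (s := [::]) isT z1; rewrite big_nil normr0.
Qed.

Lemma unconditional_scaled (s : seq nat) (a : nat -> R) c : uniq s -> 0 <= c ->
  (forall i, i \in s -> `|a i| <= c) -> `|\sum_(i <- s) a i *: u i| <= c * M.
Proof.
move=> us c0 ac; have [c00|cN0] := eqVneq c 0.
  rewrite big1_seq ?normr0 ?c00 ?mul0r// => i /andP[_ /ac].
  by rewrite c00 normr_le0 => /eqP ->; rewrite scale0r.
have {}c0 : 0 < c by rewrite lt_neqAle eq_sym cN0.
(* [uM] requires coefficients bounded at every index, hence the 0 outside [s]. *)
pose b i := if i \in s then a i / c else 0.
have -> : \sum_(i <- s) a i *: u i = c *: \sum_(i <- s) b i *: u i.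
  rewrite scaler_sumr; apply: eq_big_seq => i si.
  by rewrite /b si scalerA mulrC divfK.
rewrite normrZ gtr0_norm// ler_pM2l//; apply: uM => // i; rewrite /b.
case: ifPn => [/ac|_]; last by rewrite normr0.
by rewrite normrM normfV (gtr0_norm c0) ler_pdivrMr// mul1r.
Qed.

(** The signs of the [phi (u i)], used as coefficients, turn the sum of absolute values into a
    single value of [phi]. *)
Lemma unconditional_functional (phi : X -> R) (s : seq nat) :
  (forall (a : R) x y, phi (a *: x + y) = a * phi x + phi y) ->
  (forall x, `|phi x| <= `|x|) -> uniq s -> \sum_(i <- s) `|phi (u i)| <= M.
Proof.
move=> phil phin us.
have phi0 : phi 0 = 0 by apply/eqP; rewrite -normr_le0 -[leRHS](@normr0 _ X).
have phis (a : nat -> R) t : phi (\sum_(i <- t) a i *: u i) = \sum_(i <- t) a i * phi (u i).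
  by elim: t => [|i t IH]; rewrite ?big_nil// !big_cons phil IH.
apply: le_trans (@uM s (fun i => Num.sg (phi (u i))) us _); last first.
  by move=> i; rewrite normr_sg; case: eqP.
apply: le_trans (phin _); rewrite phis (le_trans _ (ler_norm _))//.
by apply: ler_sum => i _; rewrite normrEsg.
Qed.

End UnconditionalC0.

Lemma c0seq_supn (R : realType) (v : nat -> R) i : c0seq v -> `|v i| <= supn v.
Proof.
move=> v0; have /cvg_seq_bounded/pinfty_ex_gt0[M _ vM] := cvgP _ v0.
by apply: (@supn_ub _ _ _ _ M) => n; exact: vM.
Qed.

Section UnconditionalSeries.
Variables (R : realType) (X : completeNormedModType R) (u : nat -> X) (M : R).
Hypothesis uM : unconditional u M.
Implicit Type v : nat -> R.

Lemma unconditional_cvg v : c0seq v -> cvgn (series (fun i => v i *: u i)).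
Proof.
move=> v0; apply/cauchy_cvgP/cauchy_seriesP => e e0.
have M0 := unconditional_ge0 uM.
(* [M] itself may be 0. *)
have d0 : 0 < e / (M + 1) by rewrite divr_gt0// ltr_wpDl.
have /cvgrPdist_lt/(_ _ d0)[N _ hN] := v0.
exists ([set n | (N <= n)%N], [set n | (N <= n)%N]) => /=; first by split; exists N.
move=> [m n] /= [Nm _]; have := @unconditional_scaled _ _ u M uM (index_iota m n) v (e / (M + 1)) (iota_uniq _ _) (ltW d0).
move=> /(_ _)/le_lt_trans; apply.
  move=> i; rewrite mem_index_iota => /andP[mi _].
  by have := hN i (leq_trans Nm mi); rewrite /= sub0r normrN => /ltW.
by rewrite mulrAC ltr_pdivrMr ?ltr_wpDl// ltr_pM2l// ltrDl.
Qed.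

Lemma unconditional_lim_le v : c0seq v ->
  `|limn (series (fun i => v i *: u i))| <= supn v * M.
Proof.
move=> v0; have /cvg_norm cn := unconditional_cvg v0.
rewrite -(cvg_lim _ cn)//; apply: limr_le; first exact: cvgP cn.
near=> n; apply: (unconditional_scaled uM); first exact: iota_uniq.
  exact: supn_ge0.
by move=> i _; exact: c0seq_supn.
Unshelve. all: by end_near. Qed.

(** Apply [phi] to partial sums beyond [n]: the [n]-th term gives at least [d * |v n|], and all the
    others together at most [supn v * (d / 2)]. *)
Lemma unconditional_lim_ge v (d : R) (phi : X -> R) n : c0seq v -> 0 < d ->
  (forall (a : R) x y, phi (a *: x + y) = a * phi x + phi y) ->
  (forall x, `|phi x| <= `|x|) -> d <= `|phi (u n)| ->
  (forall s, uniq s -> n \notin s -> \sum_(k <- s) `|phi (u k)| <= d / 2) ->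
  d * `|v n| - supn v * (d / 2) <= `|limn (series (fun i => v i *: u i))|.
Proof.
move=> v0 d0 phil phin un phis; have /cvg_norm cn := unconditional_cvg v0.
rewrite -(cvg_lim _ cn)//; apply: limr_ge; first exact: cvgP cn.
have phi0 : phi 0 = 0 by apply/eqP; rewrite -normr_le0 -[leRHS](@normr0 _ X).
have phiS t : phi (\sum_(i <- t) v i *: u i) = \sum_(i <- t) v i * phi (u i).
  by elim: t => [|i t IH]; rewrite ?big_nil// !big_cons phil IH.
near=> N; apply: le_trans (phin _).
rewrite /= /series /= phiS (bigD1_seq n) ?iota_uniq//=; last first.
  by rewrite mem_index_iota; near: N; exact: nbhs_infty_gt.
rewrite -big_filter.
set s := [seq _ <- _ | _].
have us : uniq s by rewrite filter_uniq// iota_uniq.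
have ns : n \notin s by rewrite mem_filter eqxx.
apply: le_trans (lerB_normD _ _); apply: lerB.
  by rewrite normrM mulrC ler_wpM2l.
apply: (le_trans (ler_norm_sum _ _ _)).
apply: le_trans (ler_wpM2l (supn_ge0 v) (phis s us ns)).
rewrite mulr_sumr; apply: ler_sum => i _; rewrite normrM ler_wpM2r//.
exact: c0seq_supn.
Unshelve. all: by end_near. Qed.

End UnconditionalSeries.

Lemma unconditional_comp (R : realType) (X : normedModType R) (u : nat -> X) M
    (sigma : nat -> nat) :
  injective sigma -> unconditional u M -> unconditional (u \o sigma) M.
Proof.
move=> sI uM s a us a1.
(* A left inverse of [sigma] transports the coefficients to the range of [sigma]. *)
have [tau tauK] : exists tau : nat -> nat, forall i, tau (sigma i) = i.
  have /choice[tau htau] : forall j, exists i, forall k, sigma k = j -> i = k.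
    move=> j; have [[k <-]|nk] := pselect (exists k, sigma k = j).
      by exists k => l /sI.
    by exists 0%N => k kj; case: nk; exists k.
  by exists tau => i; exact: htau.
have := uM (map sigma s) (a \o tau); rewrite big_map map_inj_uniq//.
under eq_bigr do rewrite /= tauK.
by apply => // i; exact: a1.
Qed.

Lemma unconditional_contains_c0 (R : realType) (X : completeNormedModType R)
    (u : nat -> X) (M d : R) :
  unconditional u M -> 0 < d -> (forall n, d <= `|u n|) -> contains_c0 X.
Proof.
move=> uM d0 ud.
have /choice[phi hphi] n := norming_functional (u n).
have [||n s us|sigma sI hs] := @rosenthal_disjointification R
    (fun n k => `|phi n (u k)|) M (d / 2); first by rewrite divr_gt0.
- by [].
- by have [? ? ?] := hphi n; exact: (unconditional_functional uM).
have wM := unconditional_comp sI uM; set w := u \o sigma in wM.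
exists (fun v => limn (series (fun i => v i *: w i))); split.
  move=> a v v' v0 v'0; apply: cvg_lim => //.
  have -> : series (fun i => (a * v i + v' i) *: w i) =
      (fun n => a *: series (fun i => v i *: w i) n + series (fun i => v' i *: w i) n).
    apply/funext => n; rewrite /series /= scaler_sumr -big_split /=.
    by apply: eq_bigr => i _; rewrite scalerDl scalerA.
  by apply: cvgD; [apply: cvgZl_tmp|]; exact: unconditional_cvg wM _ _.
have M0 := unconditional_ge0 uM.
exists (d / 2), (M + 1); split; first by rewrite divr_gt0.
split; first by rewrite ltr_wpDl.
move=> v v0; split; last first.
  apply: (le_trans (unconditional_lim_le wM v0)); rewrite mulrC ler_wpM2r ?supn_ge0//.
  by rewrite lerDl.
set l := `|_|.
have vl n : d * `|v n| - supn v * (d / 2) <= l.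
  have [p1 p2 p3] := hphi (sigma n).
  by apply: (unconditional_lim_ge wM v0 d0 p1 p2); [rewrite p3 ger0_norm|exact: hs].
(* The supremum over [n] in [vl] gives [d * supn v <= l + supn v * (d / 2)], and the last term is
   absorbed on the left. *)
suff : supn v <= d^-1 * (l + supn v * (d / 2)) by rewrite ler_pdivlMl//; lra.
apply: supn_le; last by move=> n; rewrite ler_pdivlMl//; have := vl n; lra.
apply: mulr_ge0; first by rewrite invr_ge0 ltW.
by apply: addr_ge0; [exact: normr_ge0|rewrite mulr_ge0 ?supn_ge0//; lra].
Qed.

(** * Functions vanishing at infinity *)

Section C0Theory.
Variables (R : realType) (K : topologicalType) (V : normedModType R).
Implicit Type f g : K -> V.

Lemma closed_norm_ge f (e : R) : continuous f -> closed [set x | e <= `|f x|].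
Proof.
move=> cf; apply: (@closed_comp _ _ (fun x => `|f x|) [set r : R | e <= r]).
  by move=> x _; apply: (@cvg_norm _ _ _ _ _ f); exact: cf.
exact: closed_ge.
Qed.

Lemma C0_lin (a : R) f g : C0 f -> C0 g -> C0 (fun x => a *: f x + g x).
Proof.
move=> [cf kf] [cg kg].
have ch : continuous (fun x => a *: f x + g x).
  by move=> x; apply: cvgD; [apply: cvgZl_tmp; exact: cf|exact: cg].
split=> // e e0; pose b := `|a| + 1.
have b0 : 0 < b by rewrite ltr_wpDl.
have eb0 : 0 < e / (2 * b) by rewrite divr_gt0// mulr_gt0.
have e20 : 0 < e / 2 by rewrite divr_gt0.
apply: subclosed_compact (closed_norm_ge (e := e) ch) (compactU (kf _ eb0) (kg _ e20)) _.
move=> x /= ex; have [gx|gx] := leP (e / 2) `|g x|; [by right|left].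
rewrite ler_pdivrMr; last by rewrite mulr_gt0.
have := le_trans ex (ler_normD _ _); rewrite normrZ.
have : `|a| * `|f x| <= b * `|f x| by rewrite ler_wpM2r// /b lerDl.
by rewrite mulrCA; lra.
Qed.

Lemma C0_uniform_closed f :
  (forall e : R, 0 < e -> exists2 g, C0 g & forall x, `|f x - g x| <= e) -> C0 f.
Proof.
move=> fg.
have cf : continuous f.
  move=> x; apply/cvgrPdist_le => e e0; have e30 : 0 < e / 3 by rewrite divr_gt0.
  have [g [cg _] hg] := fg _ e30.
  have /cvgrPdist_le/(_ _ e30) := cg x; apply: filterS => t gt.
  have -> : f x - f t = (f x - g x) + (g x - g t) - (f t - g t).
    by rewrite subrKA opprB subrKA.
  apply: (le_trans (ler_normB _ _)); have := ler_normD (f x - g x) (g x - g t).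
  have := hg x; have := hg t; lra.
split=> // e e0; have e20 : 0 < e / 2 by rewrite divr_gt0.
have [g [_ kg] hg] := fg _ e20.
apply: subclosed_compact (closed_norm_ge (e := e) cf) (kg _ e20) _ => x /= ex.
have := hg x; have := ler_normD (f x - g x) (g x); rewrite subrK; lra.
Qed.

Lemma C0_bounded f : C0 f -> exists M : R, forall x, `|f x| <= M.
Proof.
move=> [cf kf]; have := kf 1 ltr01; set A := [set _ | _] => kA.
have /compact_bounded/pinfty_ex_gt0[M M0 hM] : compact (f @` A).
  by apply: continuous_compact kA; exact: continuous_subspaceT.
exists (M + 1) => x; have [fx|fx] := leP 1 `|f x|.
  by apply: (@le_trans _ _ M); [apply: hM; exists x|rewrite lerDl].
by rewrite (le_trans (ltW fx))// lerDr ltW.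
Qed.

Lemma C0_supn f x : C0 f -> `|f x| <= supn f.
Proof. by move=> /C0_bounded[M fM]; exact: supn_ub fM. Qed.

(** The maximum is sought on the compact set where [|f|] is at least half its supremum. *)
Lemma C0_supn_attained f : C0 f -> 0 < supn f -> exists x, `|f x| = supn f.
Proof.
move=> f0 s0; have [cf kf] := f0.
have s20 : 0 < supn f / 2 by rewrite divr_gt0.
have [x xA] : exists x, supn f / 2 <= `|f x|.
  apply/not_existsP => H; have : supn f <= supn f / 2; last by lra.
  by apply: supn_le (ltW s20) _ => x; rewrite leNgt; apply/negP => /ltW /H.
have [||c cA cmax] := @compact_EVT_max _ R (fun x => `|f x|) _ _ (kf _ s20).
- by exists x.
- apply: continuous_subspaceT => z; apply: (@cvg_norm _ _ _ _ _ f); exact: cf.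
exists c; apply/eqP; rewrite eq_le C0_supn//=.
apply: supn_le => // z; have [zA|/ltW zA] := leP (supn f / 2) `|f z|.
  by apply: cmax; rewrite inE.
by apply: (le_trans zA); rewrite inE in cA.
Qed.

Lemma C0_mul f (k : K -> R) : C0 f -> continuous k -> (forall x, `|k x| <= 1) ->
  C0 (fun x => k x *: f x).
Proof.
move=> [cf kf] ck k1.
have ch : continuous (fun x => k x *: f x).
  by move=> x; apply: cvgZ; [exact: ck|exact: cf].
split=> // e e0; apply: subclosed_compact (closed_norm_ge (e := e) ch) (kf _ e0) _.
by move=> x /= ex; apply: (le_trans ex); rewrite normrZ ler_piMl.
Qed.

End C0Theory.

(** * Urysohn functions on locally compact Hausdorff spaces *)

Section Cutoff.
Variables (R : realType) (K : topologicalType).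
Hypotheses (hK : hausdorff_space K) (lK : locally_compact [set: K]).

Lemma locally_compact_nbhs (x : K) : exists C, [/\ nbhs x C, compact C & closed C].
Proof.
have [C xC [cC clC]] := lK (I : [set: K] x).
by exists C; split => //; move: xC; rewrite /within/=; apply: filterS => t; apply.
Qed.

Lemma cutoff (x : K) (U : set K) : nbhs x U -> exists k : K -> R,
  [/\ continuous k, forall t, 0 <= k t <= 1, nbhs x [set t | k t = 1] &
      forall t, ~ U t -> k t = 0].
Proof.
move=> xU.
have : uniform_separator [set x] (~` U°).
  apply: (locally_compact_completely_regular (R := R)) => //.
    by apply: open_closedC; exact: open_interior.
move=> /(uniform_separatorP (R := R))[f [cf f01 fx fU]].
have {}f01 t : 0 <= f t <= 1 by have := f01 (f t); rewrite /= in_itv /=; apply; exists t.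
have {}fx : f x = 0 by apply: fx; exists x.
(* The truncation makes [k] equal to 1 wherever [f <= 1 / 2], so on a whole neighbourhood of [x]. *)
pose k t := Num.min (1 : R) (2 * (1 - f t)).
exists k; split.
- move=> t; apply: (@continuous_min R K (cst (1 : R)) (fun t => 2 * (1 - f t))).
    exact: cvg_cst.
  apply: cvgM; first exact: cvg_cst.
  by apply: cvgB; [exact: cvg_cst|exact: cf].
- move=> t; rewrite /k le_min ge_min lexx ler01 /= andbT.
  by have := f01 t; lra.
- have h0 : (0 : R) < 1 / 2 by rewrite divr_gt0.
  have /cvgrPdist_le/(_ _ h0) := cf x; apply: filterS => t /=.
  rewrite fx sub0r normrN => ft; apply: min_idPl.
  by have := ler_norm (f t); lra.
- move=> t Ut; have : f t = 1.
    by apply: fU; exists t => //; apply: contra_not Ut; exact: interior_subset.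
  by rewrite /k => ->; rewrite subrr mulr0 min_r.
Qed.

Lemma C0_cutoff (x : K) (U : set K) : nbhs x U -> exists k : K -> R,
  [/\ C0 k, forall t, 0 <= k t <= 1, k x = 1 & forall t, ~ U t -> k t = 0].
Proof.
move=> xU; have [C [xC cC clC]] := locally_compact_nbhs x.
have [k [ck k01 kx kU]] := cutoff (filterI xU xC).
exists k; split => //; last by move=> t Ut; apply: kU => -[].
  split=> // e e0; apply: subclosed_compact (closed_norm_ge (e := e) ck) cC _.
  move=> t /= et; apply: contrapT => Ct; move: et.
  by rewrite kU ?normr0 ?leNgt ?e0// => -[].
exact: nbhs_singleton kx.
Qed.

End Cutoff.

(** * Points of concentration *)

Section DisjointNbhs.
Variable K : topologicalType.
Hypotheses (hK : hausdorff_space K) (lK : locally_compact [set: K]).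

(** [z] is a cluster point of the filter of sets containing all but finitely many points of [S]. If
    [S] met [N] in a finite set, the complement of [N] would belong to that filter. *)
Lemma infinite_compact_accumulation (S C : set K) : compact C -> infinite_set S ->
  S `<=` C -> exists z : K, forall N, nbhs z N -> infinite_set (S `&` N).
Proof.
move=> cC iS SC; pose F : set_system K := [set E | finite_set (S `\` E)].
have FF : ProperFilter F.
  apply: Build_ProperFilter_ex.
    move=> E fE; apply/set0P/eqP => E0; apply: iS; move: fE.
    by rewrite /F /= E0 setD0.
  split.
  - by rewrite /F /= setDT; exact: finite_set0.
  - by move=> P Q fP fQ; rewrite /F /= setDIr finite_setU.
  - by move=> P Q PQ; apply: sub_finite_set; exact: setDS.
have [|z [_ zF]] := cC F FF.
  rewrite /F /= (_ : S `\` C = set0); first exact: finite_set0.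
  by rewrite setD_eq0.
exists z => N zN fSN.
have [t [/= nt Nt]] : (~` N) `&` N !=set0.
  apply: zF => //; rewrite /F /=.
  by rewrite setDE setCK.
by [].
Qed.

(** Let [C] be a compact neighbourhood of some [b]. If infinitely many points lie outside [C], cut
    [C] off. Otherwise infinitely many lie in [C] and accumulate at some [z]; then separate from [z]
    a point [b'] other than [z]. *)
Lemma split_off_nbhs (A O : set K) : open O -> infinite_set (A `&` O) ->
  exists (b : K) U V, [/\ A b, nbhs b U, U `<=` O, open V &
    [/\ V `<=` O, U `&` V = set0 & infinite_set (A `&` V)]].
Proof.
move=> oO iAO; have [b [Ab Ob]] := infinite_setN0 iAO.
have [C [bC cC clC]] := locally_compact_nbhs lK b.
have [fAC|iAC] := pselect (finite_set ((A `&` O) `\` C)); last first.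
  exists b, (C `&` O), (O `\` C); split=> //.
  - by apply: filterI => //; exact: open_nbhs_nbhs.
  - by rewrite setDE; apply: openI => //; exact: closed_openC.
  - split=> //; last by rewrite setIDA.
    by apply/seteqP; split=> // t [[Ct _] [_ /(_ Ct)]].
have iAOC : infinite_set ((A `&` O) `&` C).
  move=> fAOC; apply: iAO; rewrite -(setIT (A `&` O)) -(setUv C) setIUr -setDE.
  by rewrite finite_setU.
have [z zN] := infinite_compact_accumulation cC iAOC (@subIsetr _ _ _).
have [b' [[Ab' Ob'] b'z]] : ((A `&` O) `\` [set z]) !=set0.
  by apply: infinite_setN0; apply: infinite_setD => //; exact: finite_set1.
have := hK; rewrite open_hausdorff => /(_ _ _ (introN eqP b'z)).
move=> [[P Q] /=]; rewrite !inE => -[Pb' Qz] [oP oQ PQ].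
exists b', (P `&` O), (Q `&` O); split=> //.
- by apply: filterI; apply: open_nbhs_nbhs.
- exact: openI.
- split=> //.
    by apply/seteqP; split=> // t [[Pt _] [Qt _]]; have : (P `&` Q) t by []; rewrite PQ.
  apply: sub_infinite_set (zN Q _); last exact: open_nbhs_nbhs.
  by move=> t [[[At Ot] _] Qt].
Qed.

(** Iterate [split_off_nbhs], each time inside the open set left by the previous step. *)
Lemma infinite_disjoint_nbhs (A : set K) : infinite_set A ->
  exists (x : nat -> K) (U : nat -> set K), [/\ forall n, A (x n),
    forall n, nbhs (x n) (U n) & forall m n t, m != n -> U m t -> ~ U n t].
Proof.
move=> iA; pose St := {O : set K | open O /\ infinite_set (A `&` O)}.
have H (O : St) : exists r : K * set K * St, [/\ A r.1.1, nbhs r.1.1 r.1.2,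
    r.1.2 `<=` sval O, sval r.2 `<=` sval O & r.1.2 `&` sval r.2 = set0].
  case: O => O [oO iO]; have [b [U [V [Ab bU UO oV [VO UV iV]]]]] := split_off_nbhs oO iO.
  by exists (b, U, exist _ V (conj oV iV)).
have [h hh] := choice H.
have T0 : open [set: K] /\ infinite_set (A `&` setT) by rewrite setIT; split => //; exact: openT.
pose O n := iter n (fun O => (h O).2) (exist _ setT T0 : St).
have Odec m k : sval (O (m + k)%N) `<=` sval (O m).
  elim: k => [|k IH]; first by rewrite addn0.
  rewrite addnS; have [_ _ _ + _] := hh (O (m + k)%N).
  by move=> /subset_trans; apply.
have disj m n t : (m < n)%N -> (h (O m)).1.2 t -> ~ (h (O n)).1.2 t.
  move=> mn Um Un; have [_ _ _ _ UV] := hh (O m).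
  suff : ((h (O m)).1.2 `&` sval (h (O m)).2) t by rewrite UV.
  split => //; have [_ _ + _ _] := hh (O n); move=> /(_ _ Un).
  by rewrite -(subnKC mn); exact: Odec.
exists (fun n => (h (O n)).1.1), (fun n => (h (O n)).1.2); split.
- by move=> n; case: (hh (O n)).
- by move=> n; case: (hh (O n)).
- move=> m n t; rewrite neq_ltn => /orP[mn|nm]; first exact: disj.
  by move=> Um Un; exact: disj nm Un Um.
Qed.

End DisjointNbhs.

(** * Bounded operators on disjointly supported functions *)

Section Embedding.
Variables (R : realType) (K L : topologicalType) (X : completeNormedModType R).
Variables (T : (K -> R) -> L -> X) (B : R).
Hypothesis TC0 : forall f, C0 f -> C0 (T f).
Hypothesis Tlin : forall (a : R) (f g : K -> R), C0 f -> C0 g ->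
  T (fun x => a * f x + g x) = (fun y => a *: T f y + T g y).
Hypothesis TB : forall f, C0 f -> supn (T f) <= B * supn f.
Hypothesis B0 : 0 < B.
Hypothesis hX : ~ contains_c0 X.
Implicit Types f g : K -> R.

Lemma C0_0 : C0 (fun _ : K => 0 : R).
Proof.
split=> [|e e0]; first exact: cst_continuous.
rewrite (_ : [set _ | _] = set0); first exact: compact0.
by apply/seteqP; split=> // x /=; rewrite normr0 leNgt e0.
Qed.

Lemma C0_comb (a : R) f g : C0 f -> C0 g -> C0 (fun x => a * f x + g x).
Proof. exact: C0_lin. Qed.

Lemma C0_sum (I : Type) (s : seq I) (a : I -> R) (g : I -> K -> R) :
  (forall i, C0 (g i)) -> C0 (fun x => \sum_(i <- s) a i * g i x).
Proof.
move=> g0; elim: s => [|i s IH].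
  by under eq_fun do rewrite big_nil; exact: C0_0.
by under eq_fun do rewrite big_cons; exact: C0_comb.
Qed.

Lemma T_0 : T (fun=> 0) = fun=> 0.
Proof.
have := Tlin 1 C0_0 C0_0.
rewrite (_ : (fun x => 1 * 0 + 0) = (fun _ : K => 0 : R)); last by apply/funext => x; rewrite mulr0 addr0.
move=> /funeqP H; apply/funext => y; have := H y.
by rewrite scale1r -[LHS]addr0 => /addrI.
Qed.

Lemma T_sum (I : Type) (s : seq I) (a : I -> R) (g : I -> K -> R) y :
  (forall i, C0 (g i)) ->
  T (fun x => \sum_(i <- s) a i * g i x) y = \sum_(i <- s) a i *: T (g i) y.
Proof.
move=> g0; elim: s => [|i s IH].
  by under eq_fun do rewrite big_nil; rewrite T_0 big_nil.
under eq_fun do rewrite big_cons.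
by rewrite Tlin// ?big_cons ?IH//; exact: C0_sum.
Qed.

Lemma T_le f (c : R) y : C0 f -> 0 <= c -> (forall x, `|f x| <= c) -> `|T f y| <= B * c.
Proof.
move=> f0 c0 fc; apply: (le_trans (C0_supn y (TC0 f0))); apply: (le_trans (TB f0)).
by rewrite ler_pM2l//; exact: supn_le.
Qed.

(** At each point at most one summand is nonzero, so the combinations of the [g n] keep norm at most
    1. *)
Lemma disjoint_unconditional (g : nat -> K -> R) y :
  (forall n, C0 (g n)) -> (forall n x, `|g n x| <= 1) ->
  (forall m n x, m != n -> g m x = 0 \/ g n x = 0) ->
  unconditional (fun n => T (g n) y) B.
Proof.
move=> g0 g1 gd s a us a1; rewrite -T_sum// -[leRHS]mulr1.
apply: T_le => //; first exact: C0_sum.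
move=> x; have [[i [si gi]]|H] := pselect (exists i, i \in s /\ g i x != 0).
  rewrite (bigD1_seq i)//= big1 ?addr0.
    by rewrite normrM mulr_ile1.
  by move=> j ji; have [->|gi0] := gd j i x ji; [rewrite mulr0|rewrite gi0 eqxx in gi].
rewrite big1_seq ?normr0// => i /andP[_ si].
by have [->|gi] := eqVneq (g i x) 0; [rewrite mulr0|case: H; exists i].
Qed.

Lemma disjoint_small (g : nat -> K -> R) y (d : R) : 0 < d ->
  (forall n, C0 (g n)) -> (forall n x, `|g n x| <= 1) ->
  (forall m n x, m != n -> g m x = 0 \/ g n x = 0) ->
  exists N, forall n, (N <= n)%N -> `|T (g n) y| < d.
Proof.
move=> d0 g0 g1 gd; apply: contrapT => /forallNP H; apply: hX.
have {}H N : exists n, (N <= n)%N /\ d <= `|T (g n) y|.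
  have /existsNP[n /not_implyP[Nn /negP]] := H N.
  by rewrite -leNgt => dn; exists n.
have [h hh] := choice H.
pose sigma := fix sigma n := if n is n'.+1 then h (sigma n').+1 else h 0%N.
have sS n : (sigma n < sigma n.+1)%N by have [] := hh (sigma n).+1.
have sI : injective sigma.
  have sinc : {homo sigma : m n / (m < n)%N} by apply: homo_ltn sS; exact: ltn_trans.
  move=> m n mn; apply/eqP; case: (ltngtP m n) => // /sinc; rewrite mn ltnn//.
apply: (@unconditional_contains_c0 _ _ _ B d (unconditional_comp sI (disjoint_unconditional y g0 g1 gd))) => //.
by case=> [|n] /=; [case: (hh 0%N)|case: (hh (sigma n).+1)].
Qed.

Definition concentrates (d : R) (y : L) (x : K) : Prop :=
  forall W, nbhs x W -> exists g, [/\ C0 g, forall t, `|g t| <= 1,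
    forall t, ~ W t -> g t = 0 & d <= `|T g y|].

Lemma concentrates_finite (d : R) y :
  hausdorff_space K -> locally_compact [set: K] -> 0 < d -> finite_set (concentrates d y).
Proof.
move=> hK lK d0; apply: contrapT => /(infinite_disjoint_nbhs hK lK)[x [U [xd xU Ud]]].
have /choice[g hg] n := xd n _ (xU n).
have [||m n t mn|N hN] := @disjoint_small g y d d0.
- by move=> n; case: (hg n).
- by move=> n; case: (hg n).
- have [Um|Um] := pselect (U m t); last by left; case: (hg m) => _ _ -> .
  by right; case: (hg n) => _ _ -> //; exact: Ud mn Um.
have := hN N (leqnn N); have [_ _ _] := hg N.
by rewrite leNgt => /negP.
Qed.

End Embedding.

(** * Concentration occurs at every point *)

Section Dyadic.
Variable R : realType.

Lemma le_dyadic_eq0 (z : R) : (forall n, `|z| <= 2^-1 ^+ n) -> z = 0.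
Proof.
move=> zn; apply/eqP; rewrite -normr_le0 leNgt; apply/negP => z0.
have z0' : 0 < `|z|^-1 by rewrite invr_gt0.
have := zn (Num.bound `|z|^-1); rewrite leNgt => /negP; apply.
rewrite exprVn -[ltRHS]invrK ltf_pV2 ?posrE ?exprn_gt0//.
apply: (lt_trans (archi_boundP (ltW z0'))); rewrite -natrX ltr_nat.
exact: ltn_expl.
Qed.

(** [r n] is the sum over [i] of [f (n + i) / 2 ^ i.+1]; the bounds and the recursion determine
    it. *)
Lemma dyadic_tails (K : Type) (f : nat -> K -> R) :
  (forall n t, 0 <= f n t <= 1) ->
  exists r : nat -> K -> R, (forall n t, 0 <= r n t <= 1) /\
    (forall n t, r n t = 2^-1 * f n t + 2^-1 * r n.+1 t).
Proof.
move=> f01.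
pose s n t k : R := \sum_(i < k) 2^-1 ^+ i.+1 * f (n + i)%N t.
have c0 i : 0 <= 2^-1 ^+ i :> R by rewrite exprn_ge0// invr_ge0.
have s_nd n t : {homo s n t : k l / (k <= l)%N >-> k <= l}.
  apply/nondecreasing_seqP => k; rewrite /s big_ord_recr/= lerDl mulr_ge0//.
  by have /andP[] := f01 (n + k)%N t.
have s0 n t k : 0 <= s n t k.
  by apply: sumr_ge0 => i _; rewrite mulr_ge0//; have /andP[] := f01 (n + i)%N t.
have s1 n t k : s n t k <= 1.
  (* The sharper bound is the one that survives induction. *)
  suff : s n t k <= 1 - 2^-1 ^+ k by move=> /le_trans; apply; rewrite gerBl.
  rewrite /s; elim: k => [|k IH]; first by rewrite big_ord0 expr0 subrr.
  rewrite big_ord_recr/=; have /andP[_ fk] := f01 (n + k)%N t.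
  have := ler_wpM2l (c0 k.+1) fk; rewrite mulr1 exprS; lra.
have s_cvg n t : cvgn (s n t).
  by apply: nondecreasing_is_cvgn => //; exists 1 => _ [k _ <-].
exists (fun n t => limn (s n t)); split => n t.
  by apply/andP; split; [apply: limr_ge|apply: limr_le]; rewrite ?s_cvg//; near=> k.
apply: cvg_lim => //; rewrite -cvg_shiftS.
have -> : (fun k => s n t k.+1) = (fun k => 2^-1 * f n t + 2^-1 * s n.+1 t k).
  apply/funext => k; rewrite /s big_ord_recl addn0 expr1 mulr_sumr; congr (_ + _).
  by apply: eq_bigr => i _; rewrite mulrA -exprS addSnnS.
apply: cvgD; first exact: cvg_cst.
by apply: cvgM; [exact: cvg_cst|exact: s_cvg].
Unshelve. all: by end_near. Qed.

End Dyadic.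

(** * Simons' argument at a point without concentration *)

Section ConcentrationEverywhere.
Variables (R : realType) (K L : topologicalType) (X : completeNormedModType R).
Variables (T : (K -> R) -> L -> X) (A B : R).
Hypotheses (hK : hausdorff_space K) (lK : locally_compact [set: K]).
Hypothesis TC0 : forall f, C0 f -> C0 (T f).
Hypothesis Tlin : forall (a : R) (f g : K -> R), C0 f -> C0 g ->
  T (fun x => a * f x + g x) = (fun y => a *: T f y + T g y).
Hypothesis TA : forall f, C0 f -> A * supn f <= supn (T f).
Hypothesis TB : forall f, C0 f -> supn (T f) <= B * supn f.
Hypotheses (A0 : 0 < A) (B0 : 0 < B).
Hypothesis hX : ~ contains_c0 X.
Implicit Types f g : K -> R.

Definition bump (x : K) (U : set K) f : Prop :=
  [/\ C0 f, forall t, 0 <= f t <= 1, f x = 1 & forall t, ~ U t -> f t = 0].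

(** Up to [d], the size of [T f] at [y] is due to a function living off [N] and where [f] does not
    vanish. This function may vary with [y]; the aim is an [N] that does not. *)
Definition residue f (d : R) (N : set K) (y : L) : Prop :=
  exists g, [/\ C0 g, forall t, `|g t| <= 1, forall t, f t = 0 -> g t = 0,
    forall t, N t -> g t = 0 & `|T f y| <= d + `|T g y|].

Lemma residue_near (x : K) f (d : R) : 0 < d -> (forall y, ~ concentrates T d y x) ->
  C0 f -> (forall t, `|f t| <= 1) ->
  exists2 N, nbhs x N & forall y, residue f d N y.
Proof.
move=> d0 nc f0 f1; have [ctf ktf] := TC0 f0.
(* [F] expresses that a property holds for all sufficiently small sets [N']. Covering compactness of
   the set where [|T f| >= d] along [F] makes [N] uniform in [y]. *)
pose F : set_system (set K) :=
  [set E | exists2 N, nbhs x N & forall N', N' `<=` N -> E N'].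
have FF : Filter F.
  split.
  - by exists setT => //; exact: filterT.
  - move=> P Q [N xN NP] [M xM MQ]; exists (N `&` M); first exact: filterI.
    by move=> N' N'NM; split; [apply: NP|apply: MQ] => t /N'NM[].
  - by move=> P Q PQ [N xN NP]; exists N => // N' /NP /PQ.
have := ktf _ d0 => /compact_near_coveringP/(_ _ F (residue f d) FF)[].
  move=> y _; have /existsNP[W /not_implyP[xW Wy]] := nc y.
  have [k [ck k01 xk kW]] := cutoff R hK lK xW.
  have k1 t : `|k t| <= 1 by have /andP[? ?] := k01 t; rewrite ger0_norm.
  have kf0 : C0 (fun t => k t * f t) by exact: (C0_mul f0 ck k1).
  have kfy : `|T (fun t => k t * f t) y| < d.
    rewrite ltNge; apply/negP => dy; apply: Wy.
    exists (fun t => k t * f t); split=> //.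
      by move=> t; rewrite normrM mulr_ile1.
    by move=> t /kW ->; rewrite mul0r.
  have [ctkf _] := TC0 kf0.
  exists ([set y' | `|T (fun t => k t * f t) y'| < d],
          [set N' | N' `<=` [set t | k t = 1]]) => /=.
    split; last by exists [set t | k t = 1].
    have /cvg_norm cn := ctkf y.
    exact: (cvgr_lt _ cn).
  move=> [y' N'] /= [y'd N'k].
  (* This is [(1 - k) * f]: it vanishes where [k = 1], and the removed part [k * f] has image
     smaller than [d] at [y']. *)
  exists (fun t => -1 * (k t * f t) + f t); split.
  - exact: C0_comb.
  - move=> t; rewrite (_ : _ + _ = (1 - k t) * f t); last by ring.
    rewrite normrM mulr_ile1//; have /andP[? ?] := k01 t.
    by rewrite ger0_norm ?subr_ge0// gerBl.
  - by move=> t ->; rewrite !mulr0 addr0.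
  - by move=> t /N'k /= ->; rewrite mul1r mulN1r addNr.
  - rewrite Tlin//; have := ler_normD (T (fun t => k t * f t) y')
      (-1 *: T (fun t => k t * f t) y' + T f y').
    by rewrite scaleN1r addNKr; lra.
move=> N xN hN; exists N => // y.
(* Off the compact set [|T f y| < d], and [g = 0] serves. *)
have [yd|yd] := leP d `|T f y|; first exact: (hN N).
exists (fun=> 0); split=> //; first exact: C0_0.
  by move=> t; rewrite normr0.
by rewrite (T_0 Tlin) normr0 addr0 ltW.
Qed.

(** The infimum over bumps need not be attained, hence the margin [e]. The factor [1 *] matches the
    shape of [Tlin]. *)
Lemma near_minimizer (x : K) (U : set K) (a : K -> R) (e : R) : nbhs x U -> 0 < e ->
  exists2 f, bump x U f & forall g, bump x U g ->
    supn (T (fun t => 1 * a t + f t)) <= supn (T (fun t => 1 * a t + g t)) + e.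
Proof.
move=> xU e0; pose E := [set supn (T (fun t => 1 * a t + f t)) | f in bump x U].
have hE : has_inf E.
  split; last by exists 0 => _ [f _ <-]; exact: supn_ge0.
  have [k hk] := C0_cutoff R hK lK xU.
  by exists (supn (T (fun t => 1 * a t + k t))); exists k.
have [_ [f bf <-] fe] := inf_adherent e0 hE.
exists f => // g bg; apply: (le_trans (ltW fe)); rewrite lerD2r.
by apply: ge_inf; [case: hE|exists g].
Qed.


(** Along the recursion [stage_fun (s n)] is the sum over [i < n] of [2 ^ (n - 1 - i) * f i], that
    is [2 ^ n] times a partial sum of the dyadic series. *)
Record stage (x : K) := Stage {
  stage_fun : K -> R; stage_nbhs : set K;
  stage_C0 : C0 stage_fun; stage_nbhsP : nbhs x stage_nbhs }.

(* The near-minimality clause drives Simons' argument: with [F] the sum of the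
   [f n / 2 ^ n.+1], the tail [r n] competes with [f n], and
   [stage_fun (s n) + r n = 2 ^ n * F]. *)
Definition stage_step (x : K) (d : R) (n : nat) (s : stage x) f (s' : stage x) : Prop :=
  [/\ bump x (stage_nbhs s) f,
    forall g, bump x (stage_nbhs s) g ->
      supn (T (fun t => 1 * stage_fun s t + f t)) <=
      supn (T (fun t => 1 * stage_fun s t + g t)) + d * 2^-1 ^+ n.+1,
    stage_fun s' = (fun t => 2 * stage_fun s t + f t),
    stage_nbhs s' `<=` stage_nbhs s &
    forall y, residue f d (stage_nbhs s') y].

Lemma stages (x : K) (d : R) : 0 < d -> (forall y, ~ concentrates T d y x) ->
  exists (s : nat -> stage x) (f : nat -> K -> R), stage_fun (s 0%N) = (fun=> 0) /\
    forall n, stage_step d n (s n) (f n) (s n.+1).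
Proof.
move=> d0 nc.
have H (p : nat * stage x) :
    exists q : (K -> R) * stage x, stage_step d p.1 p.2 q.1 q.2.
  case: p => n [a U Ca xU].
  have e0 : 0 < d * 2^-1 ^+ n.+1 by rewrite mulr_gt0// exprn_gt0// invr_gt0.
  have [f bf fmin] := near_minimizer a xU e0; have [f0 f01 fx fU] := bf.
  have f1 t : `|f t| <= 1 by have /andP[? ?] := f01 t; rewrite ger0_norm.
  have [N xN Nf] := residue_near d0 nc f0 f1.
  exists (f, Stage (C0_comb 2 Ca f0) (filterI xU xN)); split=> //=.
  by move=> y; have [g [? ? ? gN ?]] := Nf y; exists g; split=> // t [_ /gN].
have [h hh] := choice H.
have xT : nbhs x setT by exact: filterT.
pose s := fix s n := if n is m.+1 then (h (m, s m)).2
  else Stage (C0_0 R K) xT.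
exists s, (fun n => (h (n, s n)).1); split=> // n.
exact: (hh (n, s n)).
Qed.

Lemma concentration_everywhere (x : K) : exists y, concentrates T (A / 4) y x.
Proof.
apply: contrapT => /forallNP nc; set d := A / 4 in nc.
have d0 : 0 < d by rewrite divr_gt0.
have [s [f [s0 sf]]] := stages d0 nc.
pose a n := stage_fun (s n); pose U n := stage_nbhs (s n).
have Ca n : C0 (a n) by exact: stage_C0.
have Cf n : C0 (f n) by have [[]] := sf n.
have f01 n t : 0 <= f n t <= 1 by have [[]] := sf n.
have fx n : f n x = 1 by have [[]] := sf n.
have fU n t : ~ U n t -> f n t = 0 by have [[_ _ _ h] _ _ _ _] := sf n; exact: h.
have aS n : a n.+1 = (fun t => 2 * a n t + f n t) by have [] := sf n.
have Udec m k : U (m + k)%N `<=` U m.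
  elim: k => [|k IH]; first by rewrite addn0.
  by rewrite addnS; apply: subset_trans IH; have [] := sf (m + k)%N.
have [r [r01 rS]] := dyadic_tails f01.
have half0 : (0 : R) <= 2^-1 by rewrite invr_ge0.
have rsum n k t : r n t =
    \sum_(i <- iota 0 k) 2^-1 ^+ i.+1 * f (n + i)%N t + 2^-1 ^+ k * r (n + k)%N t.
  elim: k => [|k IH]; first by rewrite big_nil expr0 mul1r add0r addn0.
  have -> : iota 0 k.+1 = iota 0 k ++ [:: k] by rewrite -addn1 iotaD.
  by rewrite IH big_cat big_seq1 /= rS addnS exprSr; ring.
have rtail n k t : 0 <= 2^-1 ^+ k * r (n + k)%N t <= 2^-1 ^+ k.
  have /andP[r0 r1] := r01 (n + k)%N t.
  by rewrite mulr_ge0 ?exprn_ge0//= ler_piMr ?exprn_ge0.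
have Cr n : C0 (r n).
  apply: C0_uniform_closed => e e0.
  have [k ke] : exists k, 2^-1 ^+ k <= e.
    apply/not_existsP => H; suff e00 : e = 0 by rewrite e00 ltxx in e0.
    apply/le_dyadic_eq0 => k; rewrite gtr0_norm//.
    by apply/ltW; rewrite ltNge; apply/negP; exact: H.
  exists (fun t => \sum_(i <- iota 0 k) 2^-1 ^+ i.+1 * f (n + i)%N t).
    exact: (@C0_sum _ _ _ _ (fun i => 2^-1 ^+ i.+1) (fun i => f (n + i)%N)).
  move=> t; rewrite (rsum n k) addrC addKr; have /andP[h1 h2] := rtail n k t.
  by rewrite ger0_norm// (le_trans h2).
have rx n : r n x = 1.
  apply/eqP; rewrite -subr_eq0; apply/eqP/le_dyadic_eq0 => k.
  have e n' : r n' x - 1 = 2^-1 * (r n'.+1 x - 1) by rewrite rS fx; field.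
  have -> : r n x - 1 = 2^-1 ^+ k * (r (n + k)%N x - 1).
    elim: k => [|k ->]; first by rewrite expr0 mul1r addn0.
    by rewrite e mulrA -exprSr addnS.
  rewrite normrM ger0_norm ?exprn_ge0// ler_piMr ?exprn_ge0//.
  by have /andP[? ?] := r01 (n + k)%N x; rewrite ler0_norm ?subr_le0//; lra.
have rU n t : ~ U n t -> r n t = 0.
  move=> Ut; apply/le_dyadic_eq0 => k; rewrite (rsum n k) big1_seq ?add0r.
    by have /andP[h1 h2] := rtail n k t; rewrite ger0_norm.
  by move=> i _; rewrite fU ?mulr0//; apply: contra_not Ut; exact: Udec.
have br n : bump x (U n) (r n) by split=> // t; exact: rU.
have Fr n : (fun t => 2 ^+ n * r 0%N t + 0) = (fun t => 1 * a n t + r n t).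
  apply/funext => t; elim: n => [|n IH]; first by rewrite /a s0; ring.
  rewrite aS exprS; have := rS n t; move: IH; rewrite !addr0 !mul1r => IH h.
  by rewrite -mulrA IH h; field.
set S := supn (T (r 0%N)).
have SA : A <= S.
  apply: le_trans (TA (Cr 0%N)); apply: ler_peMr; first exact: ltW.
  by apply: le_trans (C0_supn x (Cr 0%N)); rewrite rx normr1.
have S0 : 0 < S by exact: lt_le_trans SA.
have [b bS] := C0_supn_attained (TC0 (Cr 0%N)) S0.
have TFr n y : 2 ^+ n *: T (r 0%N) y = T (a n) y + T (r n) y.
  have := congr1 (fun h => T h y) (Fr n).
  by rewrite !Tlin//; [rewrite (T_0 Tlin) scale1r addr0|exact: C0_0].
have n2 n : `|2 ^+ n : R| = 2 ^+ n by rewrite ger0_norm// exprn_ge0.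
(* Write [a n.+1 = a n + (a n + f n)]. Near-minimality compares [a n + f n] with
   [a n + r n = 2 ^ n * r 0], whose image has norm at most [2 ^ n * S]; the errors [d / 2 ^ n.+1]
   add up to less than [d]. *)
have Sa n : supn (T (a n)) <= (2 ^+ n - 1) * S + d * (1 - 2^-1 ^+ n).
  elim: n => [|n IH].
    rewrite /a s0 (T_0 Tlin) !expr0 !subrr mul0r mulr0 addr0.
    by apply: supn_le => // y; rewrite normr0.
  have [_ /(_ _ (br n)) fmin _ _ _] := sf n.
  have Caf : C0 (fun t => 1 * a n t + f n t) by exact: C0_comb.
  have h1 : supn (T (fun t => 1 * a n t + r n t)) <= 2 ^+ n * S.
    apply: supn_le; first by rewrite mulr_ge0 ?exprn_ge0// ltW.
    move=> y; rewrite Tlin// scale1r -TFr normrZ n2 ler_wpM2l ?exprn_ge0//.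
    exact: C0_supn (TC0 _).
  have aE : a n.+1 = (fun t => 1 * a n t + (1 * a n t + f n t)).
    by rewrite aS; apply/funext => t; ring.
  have h2 : supn (T (a n.+1)) <= supn (T (a n)) + supn (T (fun t => 1 * a n t + f n t)).
    apply: supn_le; first by rewrite addr_ge0 ?supn_ge0.
    move=> y; rewrite aE Tlin// scale1r (le_trans (ler_normD _ _))//.
    by apply: lerD; exact: C0_supn (TC0 _).
  rewrite -/(a n) in fmin.
  have e1 : (2 : R) ^+ n.+1 = 2 * 2 ^+ n by rewrite exprS.
  have e2 : (2^-1 : R) ^+ n.+1 = 2^-1 * 2^-1 ^+ n by rewrite exprS.
  rewrite e1 e2 in fmin *; nra.
(* At [b] the image of [2 ^ n * r 0] has norm [2 ^ n * S], and [a n] accounts for at most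
   [(2 ^ n - 1) * S + d] of it. *)
have rb n : A - d <= `|T (r n) b|.
  have := ler_normD (T (a n) b) (T (r n) b); rewrite -TFr normrZ n2 bS -/S.
  have := C0_supn b (TC0 (Ca n)); have := Sa n.
  have : 0 <= d * 2^-1 ^+ n by rewrite mulr_ge0 ?exprn_ge0// ltW.
  rewrite mulrBl mulrBr !mulr1 mul1r; lra.
have res n : exists g, [/\ C0 g, forall t, `|g t| <= 1, forall t, f n t = 0 -> g t = 0,
    forall t, U n.+1 t -> g t = 0 & `|T (f n) b| <= d + `|T g b|].
  by have [_ _ _ _ /(_ b)] := sf n.
have [g hg] := choice res.
have gdis m n t : (m < n)%N -> g m t = 0 \/ g n t = 0.
  move=> mn; have [Un|Un] := pselect (U n t).
    left; have [_ _ _ + _] := hg m; apply.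
    by move: Un; rewrite -(subnKC mn); exact: Udec.
  by right; have [_ _ + _ _] := hg n; apply; exact: fU.
have [||m n t|N hN] := disjoint_small (g := g) TC0 Tlin TB B0 hX b d0.
- by move=> n; have [] := hg n.
- by move=> n; have [] := hg n.
- by rewrite neq_ltn => /orP[mn|nm]; [exact: gdis|apply/or_comm; exact: gdis].
(* Here [|T (f n) b| <= 2 * d], so by [r n = (f n + r n.+1) / 2] the excess of [|T (r n) b|] over
   [2 * d] at least doubles. *)
have step n : (N <= n)%N -> 2 * (`|T (r n) b| - 2 * d) <= `|T (r n.+1) b| - 2 * d.
  move=> Nn; have [_ _ _ _ fb] := hg n; have := hN n Nn.
  have rE : r n = (fun t => 2^-1 * f n t + (2^-1 * r n.+1 t + 0)).
    by apply/funext => t; rewrite addr0.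
  have -> : T (r n) b = 2^-1 *: T (f n) b + 2^-1 *: T (r n.+1) b.
    rewrite rE Tlin//; last by apply: C0_comb => //; exact: C0_0.
    by rewrite Tlin//; [rewrite (T_0 Tlin) addr0|exact: C0_0].
  have := ler_normD (2^-1 *: T (f n) b) (2^-1 *: T (r n.+1) b).
  rewrite !normrZ (ger0_norm half0); lra.
(* Since [A = 4 * d], [rb] makes the initial excess at least [d]; its doubling will contradict the
   bound [B]. *)
have grow k : 2 ^+ k * d <= `|T (r (N + k)%N) b| - 2 * d.
  elim: k => [|k IH].
    by rewrite expr0 mul1r addn0; have := rb N; rewrite /d; lra.
  rewrite addnS; apply: le_trans (step _ (leq_addr _ _)).
  by rewrite exprS -mulrA ler_pM2l.
have rB n : `|T (r n) b| <= B.
  rewrite -[leRHS]mulr1; apply: (T_le TC0 TB B0) => // t.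
  by have /andP[? ?] := r01 n t; rewrite ger0_norm.
have Bd0 : 0 <= B / d by rewrite divr_ge0 ?ltW.
have := archi_boundP Bd0; set k := Num.bound _; rewrite ltr_pdivrMr// => Bk.
have : k%:R * d <= 2 ^+ k * d by rewrite ler_pM2r// -natrX ler_nat ltnW// ltn_expl.
have := grow k; have := rB (N + k)%N; lra.
Qed.

End ConcentrationEverywhere.

(** * Cardinality *)

Lemma infinite_set_sequence (T : Type) (A : set T) : infinite_set A ->
  exists2 e : nat -> T, injective e & forall i, A (e i).
Proof.
move=> /infiniteP/card_leP[f].
have iT (i : nat) : i \in [set: nat] by rewrite inE.
exists (fun i => sval (f (exist _ i (iT i)))) => [i j /val_inj fij|i].
  have := @inj _ _ _ f (exist _ i (iT i)) (exist _ j (iT j)).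
  by move=> /(_ (mem_set I) (mem_set I) fij) [].
exact: set_mem (svalP (f _)).
Qed.

Lemma injective_card_le (T U : Type) (h : T -> U) : injective h ->
  ([set: T] #<= [set: U])%card.
Proof.
move=> hI; have : (h @` [set: T] #= [set: T])%card.
  by apply: inj_card_eq => x y _ _; exact: hI.
by rewrite card_eq_le => /andP[_ /card_le_trans]; apply; exact: card_leT.
Qed.

(* A maximal family of injective sequences with disjoint ranges covers all but
   finitely many points, which embeds [L] in the product of the family by [nat]. *)
Lemma infinite_prod_nat_inj (L : Type) : infinite_set [set: L] ->
  exists h : L * nat -> L, injective h.
Proof.
move=> iL.
pose P (F : set (nat -> L)) := (forall e, F e -> injective e) /\
  (forall e e' i j, F e -> F e' -> e i = e' j -> e = e').
have [|F [[FI Fd] Fmax]] := @Zorn_bigcup _ P.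
  move=> C CP Ctot; split=> [e [G CG Ge]|e e' i j [G CG Ge] [G' CG' Ge']].
    by have [GI _] := CP _ CG; exact: GI.
  have [GG'|G'G] := Ctot _ _ CG CG'.
    by have [_ Gd] := CP _ CG'; apply: Gd => //; exact: GG'.
  by have [_ Gd] := CP _ CG; apply: Gd => //; exact: G'G.
pose D := [set l | exists ei : (nat -> L) * nat, F ei.1 /\ ei.1 ei.2 = l].
have fD : finite_set (~` D).
  apply: contrapT => /infinite_set_sequence[e0 e0I e0D].
  have e0F e i j : F e -> e i <> e0 j.
    by move=> Fe eij; apply: (e0D j); exists (e, i).
  apply: (Fmax (F `|` [set e0])).
    split=> [e Fe|FF]; first by left.
    by have /e0F := FF e0 (or_intror erefl) => /(_ 0%N 0%N).
  split=> [e [Fe|->]|e e' i j [Fe|->] [Fe'|->]] //; first exact: FI.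
  - exact: Fd.
  - by move/e0F => /(_ Fe).
  - by move/esym/e0F => /(_ Fe').
have [l0 [[e0 i0] [Fe0 _]]] : D !=set0.
  apply/set0P/eqP => D0; apply: iL.
  by rewrite -(setUv D) finite_setU; split; rewrite ?D0//; rewrite D0 in fD.
have /finite_set_countable/countable_injP[j jI] := fD.
have [c cF cI] : exists2 c : L -> (nat -> L) * nat,
    forall l, F (c l).1 & injective c.
  (* Doubling the indices frees the odd positions of the one sequence [e0] for the finitely many
     points outside [D]. *)
  have /choice[c hc] : forall l, exists ei : (nat -> L) * nat, F ei.1 /\
      ((D l /\ exists2 i, ei.2 = i.*2 & ei.1 i = l) \/
       (~ D l /\ ei = (e0, (j l).*2.+1))).
    move=> l; have [[[e i] [Fe el]]|nD] := pselect (D l).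
      exists (e, i.*2); split=> //; left; split; first by exists (e, i).
      by exists i.
    by exists (e0, (j l).*2.+1); split=> //; right.
  exists c => [l|l l' cll']; first by case: (hc l).
  have [_ [[Dl [i ci ei]]|[Dl cl]]] := hc l; have [_ [[Dl' [i' ci' ei']]|[Dl' cl']]] := hc l'.
  - by rewrite -ei -ei' cll'; congr ((c l').1 _); apply: double_inj; rewrite -ci -ci' cll'.
  - by have := congr1 odd ci; rewrite cll' cl' /= !odd_double.
  - by have := congr1 odd ci'; rewrite -cll' cl /= !odd_double.
  - apply: jI; rewrite ?inE//.
    by have := cll'; rewrite cl cl' => -[] /double_inj.
exists (fun p => (c p.1).1 (pickle ((c p.1).2, p.2))) => -[l n] [l' n'] /= h.
have ce := Fd _ _ _ _ (cF l) (cF l') h.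
move: h; rewrite ce => /(FI _ (cF l'))/(pcan_inj pickleK)[ci ->].
by congr (_, _); apply: cI; move: ce ci; case: (c l) => ? ?; case: (c l') => ? ? /= -> ->.
Qed.

(** For infinite [L], send [x] to some [y] with [P y x], paired with a number telling [x] apart
    within [P y], and inject [L * nat] into [L]. *)
Lemma card_le_finite_cover (K L : Type) (P : L -> set K) :
  (forall y, finite_set (P y)) -> (forall x, exists y, P y x) ->
  finite_set [set: K] \/ ([set: K] #<= [set: L])%card.
Proof.
move=> fP cP; have [fL|iL] := pselect (finite_set [set: L]).
  left; have := bigcup_finite fL (fun y _ => fP y); apply: sub_finite_set => x _.
  by have [y Py] := cP x; exists y.
right; have [h hI] := infinite_prod_nat_inj iL.
have /choice[c hc] y : exists c : K -> nat, {in P y &, injective c}.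
  exact/countable_injP/finite_set_countable.
have [p hp] := choice cP.
apply: (@injective_card_le _ _ (fun x => h (p x, c (p x) x))) => x x' /hI[pxx'].
by rewrite pxx'; apply: hc; rewrite inE// -pxx'.
Qed.

Theorem theorem1p1 (R : realType) (K L : topologicalType)
  (X : completeNormedModType R) :
  hausdorff_space K -> locally_compact [set: K] ->
  hausdorff_space L -> locally_compact [set: L] ->
  ~ contains_c0 X ->
  (separable_space X \/ dual_has_RNP X) ->
  (exists T : (K -> R) -> (L -> X), iso_embedding_C0 T) ->
  finite_set [set: K] \/ ([set: K] #<= [set: L])%card.
Proof.
move=> hK lK _ _ hX _ [T [TC0 [Tlin [A [B [A0 [B0 TAB]]]]]]].
have TA f : C0 f -> A * supn f <= supn (T f) by move=> /TAB[].
have TB f : C0 f -> supn (T f) <= B * supn f by move=> /TAB[].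
apply: (card_le_finite_cover (P := concentrates T (A / 4))).
  by move=> y; apply: (concentrates_finite TC0 Tlin TB) => //; exact: divr_gt0.
exact: (concentration_everywhere hK lK TC0 Tlin TA TB).
Qed.
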